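(* Assume (A1) differentiability, (A2) convexity, (A4) interpolation and ($\phi$) $\phi$-smoothness, and let $x_*$ be a point as in (A4). Let $\gamma>0$ be arbitrary and write $\Phi:=\phi\big(\|x_0-x_*\|,\frac1\gamma\|x_0-x_*\|\big)$. Then the iterates of SPPM satisfy, for every $k\ge1$, $$\mathbb{E}[f(\hat x_k)]-f(x_* )\le\frac{\Phi+\frac2\gamma}{2k}\|x_0-x_*\|^2,$$ where $\hat x_k$ is chosen uniformly at random from $\{x_0,\dots,x_{k-1}\}$ (independently of everything else). If in addition (A3) holds with constant $\mu>0$, then for every $k\ge0$, $$\mathbb{E}\big[\|x_k-x_*\|^2\big]\le\left(1-\frac{\mu}{\frac2\gamma+\Phi}\right)^k\|x_0-x_*\|^2 .$$
   Context: Setting: $\mathcal{D}$ is a probability distribution over samples $\xi$; for each $\xi$, $f_\xi:\mathbb{R}^d\to\mathbb{R}$; $f(x)=\mathbb{E}_{\xi\sim\mathcal{D}}[f_\xi(x)]$, with $\nabla f(x)=\mathbb{E}[\nabla f_\xi(x)]$. Assumptions: (A1) $f_\xi$ is differentiable for $\mathcal{D}$-a.e. $\xi$; (A2) $f_\xi$ is convex for $\mathcal{D}$-a.e. $\xi$; (A3) $f$ is $\mu$-strongly convex: $f(x)\ge f(y)+\langle\nabla f(y),x-y\rangle+\frac\mu2\|x-y\|^2$ for all $x,y$; (A4) (interpolation) there exists $x_*\in\mathbb{R}^d$ with $\nabla f_\xi(x_* )=0$ for $\mathcal{D}$-a.e. $\xi$; ($\phi$) there is $\phi:[0,\infty)^2\to[0,\infty)$,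 nondecreasing in each variable, such that for $\mathcal{D}$-a.e. $\xi$: $\|\nabla f_\xi(x)-\nabla f_\xi(y)\|\le\phi(\|x-y\|,\|\nabla f_\xi(y)\|)\|x-y\|$ for all $x,y$. SPPM: given $\gamma>0$ and $x_0\in\mathbb{R}^d$, with $\xi_0,\xi_1,\dots$ i.i.d. from $\mathcal{D}$, set $x_{k+1}=\arg\min_{z\in\mathbb{R}^d}\{f_{\xi_k}(z)+\frac{1}{2\gamma}\|z-x_k\|^2\}$. *)

(* Defs.v *)
From HB Require Import structures.
From mathcomp Require Import all_boot all_order all_algebra.
From mathcomp Require Import all_classical all_reals all_analysis.
Set Implicit Arguments. Unset Strict Implicit. Unset Printing Implicit Defensive.
Import Order.TTheory GRing.Theory Num.Theory.
Import numFieldNormedType.Exports.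
Local Open Scope classical_set_scope.
Local Open Scope ring_scope.

Section Defs.
Variables (R : realType) (d : nat).

(* Euclidean inner product and Euclidean norm on R^d = 'rV[R]_d
   (the library's norm on matrices is the max-norm, so we define ours). *)
Definition dotv (u v : 'rV[R]_d) : R := \sum_(i < d) u ord0 i * v ord0 i.
Definition enorm (u : 'rV[R]_d) : R := Num.sqrt (dotv u u).

Definition grad (g : 'rV[R]_d -> R) (x : 'rV[R]_d) : 'rV[R]_d :=
  \row_(i < d) ('d g x (delta_mx ord0 i : 'rV[R]_d)).

Definition vborel := g_sigma_algebraType (@open 'rV[R]_d).

End Defs.

Definition sppm {T V : Type} (prox : T -> V -> V) (x0 : V) (s : seq T) : V :=
  foldl (fun x xi => prox xi x) x0 s.

(* Expectation of a nonnegative quantity h(xi_0,...,xi_(k-1)) where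
   xi_0,...,xi_(k-1) are i.i.d. with law D (iterated integral against the
   k-fold product of D, xi_0 outermost). *)
Fixpoint Eiid {dT : measure_display} {T : measurableType dT} {R : realType}
  (D : probability T R) (k : nat) (h : seq T -> \bar R) : \bar R :=
  match k with
  | 0 => h [::]
  | k'.+1 => (\int[D]_xi Eiid D k' (fun s => h (xi :: s)))%E
  end.

Definition fmean {dT : measure_display} {T : measurableType dT} {R : realType}
  {d : nat} (D : probability T R) (F : T -> 'rV[R]_d -> R) (x : 'rV[R]_d) : R :=
  fine (\int[D]_xi (F xi x)%:E)%E.

(* Main.v *)
(* One step x+ = prox(x) satisfies x - x+ = gamma grad f_xi(x+).  The quadratic
upper bound of f_xi at x+ along [x+, x], with constant
phi(|x - x+|, |grad f_xi(x+)|) <= Phi, together with the gradient inequality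
f_xi(x+) - f_xi(xstar) <= <grad f_xi(x+), x+ - xstar>, gives
f_xi(x) - f_xi(xstar) <= (Phi/2 + 1/gamma) (|x - xstar|^2 - |x+ - xstar|^2).
Averaging over xi and telescoping gives the sublinear rate; adding the quadratic
growth of f around its minimizer gives the linear rate.

The values of the iterated expectations are never shown to be measurable: on
arbitrary nonnegative functions the integral is a lower integral, hence monotone
and superadditive, which is the direction both estimates need. *)
Require Import Defs.
From HB Require Import structures.
From mathcomp Require Import all_boot all_order all_algebra.
From mathcomp Require Import all_classical all_reals all_analysis.
From mathcomp Require Import measurable_realfun ring lra.
Import Order.TTheory GRing.Theory Num.Theory.
Import numFieldNormedType.Exports.
Local Open Scope classical_set_scope.
Local Open Scope ring_scope.

(** * Euclidean geometry of row vectors *)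

Section Euclidean.
Context {R : realType} {d : nat}.
Implicit Types u v w : 'rV[R]_d.

Lemma dotvC u v : dotv u v = dotv v u.
Proof. by apply: eq_bigr => i _; rewrite mulrC. Qed.

Lemma dotvDl u v w : dotv (u + v) w = dotv u w + dotv v w.
Proof. by rewrite -big_split; apply: eq_bigr => i _; rewrite mxE mulrDl. Qed.

Lemma dotvZl a u v : dotv (a *: u) v = a * dotv u v.
Proof. by rewrite mulr_sumr; apply: eq_bigr => i _; rewrite mxE mulrA. Qed.

Lemma dotvDr u v w : dotv u (v + w) = dotv u v + dotv u w.
Proof. by rewrite dotvC dotvDl !(dotvC u). Qed.

Lemma dotvZr a u v : dotv u (a *: v) = a * dotv u v.
Proof. by rewrite dotvC dotvZl dotvC. Qed.

Lemma dotvNl u v : dotv (- u) v = - dotv u v.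
Proof. by rewrite -scaleN1r dotvZl mulN1r. Qed.

Lemma dotvNr u v : dotv u (- v) = - dotv u v.
Proof. by rewrite dotvC dotvNl dotvC. Qed.

Lemma dotv0l u : dotv 0 u = 0.
Proof. by rewrite -(scale0r u) dotvZl mul0r. Qed.

Lemma dotvv_ge0 u : 0 <= dotv u u.
Proof. by apply: sumr_ge0 => i _; rewrite -expr2 sqr_ge0. Qed.

Lemma dotvv_eq0 u : dotv u u = 0 -> u = 0.
Proof.
move=> /eqP; rewrite psumr_eq0 => [/allP u0|i _]; last by rewrite -expr2 sqr_ge0.
apply/rowP => i; rewrite mxE; apply/eqP.
by have := u0 i (mem_index_enum i); rewrite /= mulf_eq0 orbb.
Qed.

Lemma sqr_enorm u : enorm u ^+ 2 = dotv u u.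
Proof. by rewrite sqr_sqrtr ?dotvv_ge0. Qed.

Lemma enorm_ge0 u : 0 <= enorm u.
Proof. exact: sqrtr_ge0. Qed.

Lemma enormZ a u : enorm (a *: u) = `|a| * enorm u.
Proof.
by rewrite /enorm dotvZl dotvZr mulrA -expr2 sqrtrM ?sqr_ge0// sqrtr_sqr.
Qed.

Lemma dotv_le_enorm u v : dotv u v <= enorm u * enorm v.
Proof.
apply: le_trans (ler_norm _) _.
rewrite -sqrtr_sqr /enorm -sqrtrM ?dotvv_ge0// ler_sqrt ?mulr_ge0 ?dotvv_ge0//.
have [v0|v_neq0] := eqVneq (dotv v v) 0.
  by rewrite (dotvv_eq0 _ v0) [dotv u 0]dotvC !dotv0l mulr0 expr0n.
have v_gt0 : 0 < dotv v v by rewrite lt_def v_neq0 dotvv_ge0.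
(* Cauchy-Schwarz: expanding this square gives [dotv v v] times the defect of the inequality. *)
have := dotvv_ge0 (dotv v v *: u - dotv u v *: v).
rewrite !(dotvDl, dotvDr, dotvNl, dotvNr, dotvZl, dotvZr) (dotvC v u) => h.
by rewrite -(ler_pM2l v_gt0); lra.
Qed.

End Euclidean.

(** * Derivative inequalities on the unit interval *)

Section OneVariable.
Context {R : realType}.

Lemma is_derive_add_quadratic (h : R -> R) (dh b c t : R) :
  is_derive t (1 : R) h dh ->
  is_derive t (1 : R) (fun s => h s + b * s + c * s ^+ 2) (dh + b + 2 * c * t).
Proof.
move=> hd; have -> : (fun s => h s + b * s + c * s ^+ 2) =
  h + (b \*: (id : R -> R)) + (c \*: ((id : R -> R) ^+ 2)).
  by apply/funext => s.
have d_id : is_derive t (1 : R) (id : R -> R) 1 by exact: is_derive_id.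
have D := is_deriveD (is_deriveD hd (is_deriveZ b d_id)) (is_deriveZ c (is_deriveX 2 d_id)).
apply: (is_derive_eq D); rewrite expr1.
by rewrite ![_ *: _]mulrC; ring.
Qed.

(** The derivative at 0 is a limit of nonnegative right difference quotients, and the quadratic term
    has slope 0 there. Applied along segments, it yields both the gradient inequality and the
    optimality condition. *)
Lemma derive_min_quadratic_ge0 (h : R -> R) (dh b c : R) :
  is_derive (0 : R) (1 : R) h dh ->
  (forall t, 0 < t -> t <= 1 -> h 0 <= h t + b * t + c * t ^+ 2) ->
  0 <= dh + b.
Proof.
move=> hd hmin.
have [qd] := is_derive_add_quadratic h dh b c 0 hd.
set q := fun s : R => _ in qd *.
rewrite mulr0 addr0 => <-.
have -> : 'D_1 q 0 = lim ((h^-1 *: ((q \o shift 0) (h *: 1) - q 0)) @[h --> 0^'+]).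
  by rewrite -cvg_at_rightE.
apply: limr_ge; first exact: cvgP (cvg_dnbhs_at_right qd).
near=> s.
have s0 : 0 < s by near: s; exact: nbhs_right_gt.
have s1 : s <= 1 by near: s; exact: nbhs_right_le.
have qs : q 0 <= q s.
  by have := hmin s s0 s1; rewrite /q mulr0 expr0n mulr0 !addr0.
apply: mulr_ge0; first by rewrite invr_ge0 ltW.
by rewrite /= addr0 [s *: 1]mulr1 subr_ge0.
Unshelve. all: by end_near.
Qed.

(** Mean value theorem for [h] minus the primitive [p * t + c / 2 * t ^+ 2] of the bound, so [dh]
    need not be integrated. *)
Lemma derive_le_linear (h dh : R -> R) (p c : R) :
  (forall t, is_derive t (1 : R) h (dh t)) ->
  (forall t, 0 <= t -> t <= 1 -> dh t <= p + c * t) -> h 1 <= h 0 + p + c / 2.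
Proof.
move=> hd hle.
have D t := is_derive_add_quadratic h (dh t) (- p) (- (c / 2)) t (hd t).
have cont : {within `[0, 1], continuous (fun s => h s + - p * s + - (c / 2) * s ^+ 2)}.
  by apply: continuous_subspaceT => t; apply/differentiable_continuous/derivable1_diffP.
have [t] := MVT_segment (@ler01 R) (fun t _ => D t) cont.
rewrite in_itv/= expr0n expr1n/= => /andP[t0 t1].
by have := hle t t0 t1; lra.
Qed.

End OneVariable.

(** * First-order conditions and the quadratic upper bound *)

Section Gradient.
Context {R : realType} {d : nat}.
Implicit Types (f : 'rV[R]_d -> R) (u v x y z : 'rV[R]_d).

Lemma dotv_grad f x v : differentiable f x -> dotv (grad f x) v = 'd f x v.
Proof.
move=> fx; rewrite [in RHS](row_sum_delta v) linear_sum.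
by apply: eq_bigr => i _; rewrite linearZ mxE mulrC.
Qed.

Lemma is_derive_line f y v (t : R) : differentiable f (y + t *: v) ->
  is_derive t (1 : R) (fun s : R => f (y + s *: v)) (dotv (grad f (y + t *: v)) v).
Proof.
move=> fd.
have ld : is_diff t (fun s : R => y + s *: v) (fun s => s *: v).
  have D := is_diffD (is_diff_cst y t) (is_diff_scalel t v).
  by apply: is_diff_eq D _; rewrite add0r.
have ld' : differentiable (fun s : R => y + s *: v) t by case: ld.
have fD : differentiable (f \o (fun s : R => y + s *: v)) t.
  by apply: differentiable_comp.
apply: DeriveDef; first exact: diff_derivable.
rewrite deriveE// diff_comp//.
by rewrite dotv_grad// /= diff_val scale1r.
Qed.

(** Moving from [x] along [- w], where [w = grad f x + v], the one-sided condition reads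
    [0 <= - dotv w w]. *)
Lemma grad_min f x v (a : R) : differentiable f x ->
  (forall z, f x <= f z + a * enorm (z - x) ^+ 2 + dotv v (z - x)) ->
  grad f x = - v.
Proof.
move=> fd fmin; apply/eqP; rewrite -subr_eq0 opprK; apply/eqP/dotvv_eq0.
set w := grad f x + v.
apply: le_anti; rewrite dotvv_ge0 andbT.
have fd0 : differentiable f (x + 0 *: - w) by rewrite scale0r addr0.
have D1 := is_derive_line f x (- w) 0 fd0.
have := derive_min_quadratic_ge0 _ _ (- dotv v w) (a * dotv w w) D1.
rewrite scale0r addr0 dotvNr -opprD oppr_ge0 -dotvDl; apply => t t0 t1.
have := fmin (x + t *: - w).
rewrite [x + _]addrC addrK sqr_enorm !(dotvZl, dotvZr, dotvNl, dotvNr) => h.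
lra.
Qed.

Lemma convex_grad_le f x y : differentiable f y -> convex_function setT f ->
  f y + dotv (grad f y) (x - y) <= f x.
Proof.
move=> fd fc; have fd0 : differentiable f (y + 0 *: (x - y)) by rewrite scale0r addr0.
have D1 := is_derive_line f y (x - y) 0 fd0.
(* Convexity bounds [f] above by its chord, so [- f] plus the linear term of slope [f x - f y] is
   minimal at [t = 0]. *)
have D1' := is_deriveN D1.
have := derive_min_quadratic_ge0 _ _ (f x - f y) 0 D1'.
rewrite scale0r addr0 => c.
suff : 0 <= - dotv (grad f y) (x - y) + (f x - f y) by lra.
apply: c => t t0 t1; rewrite !fctE scale0r addr0.
have := fc (Itv01 (ltW t0) t1) x y; rewrite !inE => /(_ I I).
rewrite convRE /conv/= /unstable.onem.
have -> : t *: (x : 'rV[R]_d) + (1 - t) *: (y : 'rV[R]_d) = y + t *: (x - y).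
  by rewrite scalerBl scale1r scalerBr addrCA.
by move=> h; lra.
Qed.

(** By Cauchy-Schwarz the slope along the segment grows at most linearly in [t]. The Lipschitz bound
    is asked only from [y] along this segment, since [phi] provides no global constant. *)
Lemma le_quadratic_of_grad f x y (L : R) : (forall z, differentiable f z) ->
  (forall t, 0 <= t -> t <= 1 ->
    enorm (grad f (y + t *: (x - y)) - grad f y) <= L * (t * enorm (x - y))) ->
  f x <= f y + dotv (grad f y) (x - y) + L / 2 * enorm (x - y) ^+ 2.
Proof.
move=> fd fL.
have := derive_le_linear _ _ (dotv (grad f y) (x - y)) (L * enorm (x - y) ^+ 2)
  (fun t => is_derive_line f y (x - y) t (fd _)).
rewrite scale1r scale0r addr0 [y + (x - y)]addrC subrK mulrAC; apply => t t0 t1.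
rewrite -lerBlDl -dotvNl -dotvDl.
apply: le_trans (dotv_le_enorm _ _) _.
apply: le_trans (ler_wpM2r (enorm_ge0 _) (fL t t0 t1)) _.
by rewrite le_eqVlt; apply/orP; left; apply/eqP; ring.
Qed.

End Gradient.

(** * Decrease of the squared distance in one proximal step *)

Section ProximalStep.
Context {R : realType} {d : nat}.
Implicit Types (f : 'rV[R]_d -> R) (x y z : 'rV[R]_d).

Lemma sqr_enormD x y :
  enorm (x + y) ^+ 2 = enorm x ^+ 2 + 2 * dotv x y + enorm y ^+ 2.
Proof. by rewrite !sqr_enorm !(dotvDl, dotvDr) (dotvC y x); ring. Qed.

(** Expanding the penalty around [xp] leaves a square plus a linear term with coefficient
    [gamma^-1 *: (xp - x)], as in [grad_min]. *)
Lemma grad_prox f x xp (gamma : R) : differentiable f xp ->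
  (forall z, f xp + (2 * gamma)^-1 * enorm (xp - x) ^+ 2 <=
             f z + (2 * gamma)^-1 * enorm (z - x) ^+ 2) ->
  grad f xp = gamma^-1 *: (x - xp).
Proof.
move=> fd fmin; rewrite -opprB scalerN.
apply: (grad_min _ _ _ (2 * gamma)^-1) => // z.
have := fmin z; rewrite -[z - x](subrKA xp) (sqr_enormD (z - xp) (xp - x)).
rewrite dotvZl (dotvC (xp - x)).
have -> : gamma^-1 = 2 * (2 * gamma)^-1 by rewrite invfM mulrA divff ?mul1r.
by move=> h; lra.
Qed.

(** The radius [r] is kept apart from the current distance: distances do not increase, so one
    constant serves all iterations. *)
Lemma prox_step f (phi : R -> R -> R) xs x xp (gamma r : R) :
  (forall z, differentiable f z) -> convex_function setT f -> grad f xs = 0 ->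
  (forall a b, 0 <= a -> 0 <= b -> 0 <= phi a b) ->
  (forall a a' b, 0 <= a -> a <= a' -> 0 <= b -> phi a b <= phi a' b) ->
  (forall a b b', 0 <= a -> 0 <= b -> b <= b' -> phi a b <= phi a b') ->
  (forall y z, enorm (grad f y - grad f z)
     <= phi (enorm (y - z)) (enorm (grad f z)) * enorm (y - z)) ->
  0 < gamma ->
  (forall z, f xp + (2 * gamma)^-1 * enorm (xp - x) ^+ 2 <=
             f z + (2 * gamma)^-1 * enorm (z - x) ^+ 2) ->
  enorm (x - xs) <= r ->
  enorm (xp - xs) <= enorm (x - xs) /\
  f x - f xs <= (phi r (gamma^-1 * r) / 2 + gamma^-1) *
                (enorm (x - xs) ^+ 2 - enorm (xp - xs) ^+ 2).
Proof.
move=> fd fc gs phi0 phil phir fphi gamma0 fmin xr.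
have ig0 : 0 < gamma^-1 by rewrite invr_gt0.
have gp := grad_prox _ _ _ _ (fd xp) fmin.
have minxs : f xs <= f xp.
  by have := convex_grad_le f xp xs (fd _) fc; rewrite gs dotv0l addr0.
have := convex_grad_le f xs xp (fd _) fc.
rewrite gp dotvZl -(opprB xp xs) dotvNr => fxp.
have exs : enorm (x - xs) ^+ 2 = enorm (x - xp) ^+ 2 +
    2 * dotv (x - xp) (xp - xs) + enorm (xp - xs) ^+ 2.
  by rewrite -(sqr_enormD (x - xp)) subrKA.
(* The gradient inequality at [xp] and the minimality of [xs] make the cross term nonnegative, so
   both other squares in [exs] are at most the left side. *)
have ep0 : 0 <= dotv (x - xp) (xp - xs).
  by rewrite -(pmulr_rge0 _ ig0); lra.
have le_r z : enorm z ^+ 2 <= enorm (x - xs) ^+ 2 -> enorm z <= enorm (x - xs).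
  by rewrite ler_pXn2r// nnegrE enorm_ge0.
have e0 := sqr_ge0 (enorm (x - xp)).
have p0 := sqr_ge0 (enorm (xp - xs)).
split; first by apply: le_r; lra.
have xxp : enorm (x - xp) <= r by apply: le_trans xr; apply: le_r; lra.
have r0 : 0 <= r := le_trans (enorm_ge0 _) xr.
set Phi := phi r _.
have Phi0 : 0 <= Phi by apply: phi0 => //; rewrite mulr_ge0// ltW.
have desc : f x <= f xp + dotv (grad f xp) (x - xp) + Phi / 2 * enorm (x - xp) ^+ 2.
  apply: le_quadratic_of_grad => // t t0 t1; apply: le_trans (fphi _ _) _.
  rewrite [xp + _]addrC addrK enormZ (ger0_norm t0) gp enormZ gtr0_norm//.
  have t_le : t * enorm (x - xp) <= r.
    by apply: le_trans xxp; rewrite ler_piMl ?enorm_ge0.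
  apply: ler_wpM2r; first by rewrite mulr_ge0 ?enorm_ge0.
  apply: (@le_trans _ _ (phi r (gamma^-1 * enorm (x - xp)))).
    by apply: phil; rewrite // mulr_ge0 ?enorm_ge0// ltW.
  by apply: phir; rewrite // ?mulr_ge0 ?enorm_ge0 ?ler_pM2l// ltW.
rewrite gp dotvZl -sqr_enorm in desc.
(* These two products are exactly the slack in the final estimate. *)
have P1 := mulr_ge0 Phi0 ep0; have P2 := mulr_ge0 (ltW ig0) ep0.
by rewrite exs; lra.
Qed.

End ProximalStep.

(** * Integrals of nonnegative functions without measurability *)

Section LowerIntegral.
Import HBNNSimple.
Context {dT : measure_display} {T : measurableType dT} {R : realType}.
Variable mu : {measure set T -> \bar R}.
Local Open Scope ereal_scope.
Implicit Types (f g : T -> \bar R) (h : {nnsfun T >-> R}).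

(** With [integral_le_ub], the two halves of the integral as a supremum over simple functions below
    [f]. *)
Lemma nnsfun_le_integral f h :
  (forall x, (h x)%:E <= f x) -> \int[mu]_x (h x)%:E <= \int[mu]_x f x.
Proof.
move=> hf; rewrite integral_nnsfun// patch_setT ge0_integralTE; last first.
  by move=> x; apply: le_trans (hf x); rewrite lee_fin; exact: fun_ge0.
by apply: ereal_sup_ubound; exists h.
Qed.

Lemma integral_le_ub f (M : \bar R) : (forall x, 0 <= f x) ->
  (forall h, (forall x, (h x)%:E <= f x) -> \int[mu]_x (h x)%:E <= M) ->
  \int[mu]_x f x <= M.
Proof.
move=> f0 hM; rewrite ge0_integralTE//; apply: ge_ereal_sup => _ [h hf <-].
by have := hM h hf; rewrite integral_nnsfun// patch_setT.
Qed.

Lemma ae_le_integral_majorant f g : (forall x, 0 <= f x) ->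
  measurable_fun [set: T] (g : T -> \bar R) -> {ae mu, forall x, f x <= g x} ->
  \int[mu]_x f x <= \int[mu]_x g x.
Proof.
move=> f0 mg fg; have -> : \int[mu]_x g x = \int[mu]_x g^\+ x.
  apply: ae_eq_integral => //; first exact: measurable_funepos.
  by apply: filterS fg => x fgx _; rewrite funeposE max_l// (le_trans _ fgx).
case: fg => N [mN N0 fgN]; apply: integral_le_ub => // h hf.
(* Cutting [h] to 0 on the null set [N] keeps its integral and puts it below [g^\+] everywhere. *)
pose h' := mul_nnsfun h (indic_nnsfun R (measurableC mN)).
have -> : \int[mu]_x (h x)%:E = \int[mu]_x (h' x)%:E.
  apply: ge0_ae_eq_integral => //.
  - exact/measurable_EFinP.
  - exact/measurable_EFinP.
  - by move=> x _; rewrite lee_fin; exact: fun_ge0.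
  - by move=> x _; rewrite lee_fin; exact: fun_ge0.
  exists N; split => // x /= hx; apply: contrapT => Nx; apply: hx => _.
  by rewrite /= /mindic indicE mem_set// mulr1.
apply: nnsfun_le_integral => x /=; rewrite /mindic indicE.
have [xN|xN] := boolP (x \in ~` N); last by rewrite mulr0 funeposE le_max lexx orbT.
rewrite mulr1 (le_trans (hf x))// funeposE le_max; apply/orP; left.
by apply: contrapT => fgx; move: xN; rewrite inE; apply; exact: fgN.
Qed.

(** Simple functions below [f] and [g] add up to one below the sum; the suprema are then taken one
    at a time. *)
Lemma le_integralD f g : (forall x, 0 <= f x) -> (forall x, 0 <= g x) ->
  \int[mu]_x f x + \int[mu]_x g x <= \int[mu]_x (f x + g x).
Proof.
move=> f0 g0; set S := \int[mu]_x (f x + g x).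
(* Moving a summand across needs it finite; if [x] is infinite, so is [S]. *)
have addS (x y : \bar R) : 0 <= x -> x <= S ->
    (x \is a fin_num -> y <= S - x) -> x + y <= S.
  move=> x0 xS h; have [xfin|] := boolP (x \is a fin_num).
    by rewrite -leeBrDl// h.
  by rewrite ge0_fin_numE// -leNgt leye_eq => /eqP xy; move: xS;
    rewrite xy leye_eq => /eqP ->; rewrite leey.
have fint_ge0 h : 0 <= \int[mu]_x (h x)%:E.
  by apply: integral_ge0 => x _; rewrite lee_fin; exact: fun_ge0.
have hS h : (forall x, (h x)%:E <= f x) -> \int[mu]_x (h x)%:E + \int[mu]_x g x <= S.
  move=> hf; apply: addS => //.
    by apply: nnsfun_le_integral => x; apply: (le_trans (hf x)); rewrite leeDl.
  move=> hfin; apply: integral_le_ub => // h' h'g.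
  rewrite leeBrDl// -ge0_integralD//.
  - rewrite (_ : (fun _ => _) = fun x => (add_nnsfun h h' x)%:E)//.
    by apply: nnsfun_le_integral => x; rewrite /= EFinD leeD.
  - by move=> x _; rewrite lee_fin; exact: fun_ge0.
  - exact/measurable_EFinP.
  - by move=> x _; rewrite lee_fin; exact: fun_ge0.
  - exact/measurable_EFinP.
have hSf h : (forall x, (h x)%:E <= f x) -> \int[mu]_x (h x)%:E <= S.
  move=> hf; apply: nnsfun_le_integral => x.
  by apply: (le_trans (hf x)); rewrite leeDl.
have hSg h : (forall x, (h x)%:E <= g x) -> \int[mu]_x (h x)%:E <= S.
  move=> hf; apply: nnsfun_le_integral => x.
  by apply: (le_trans (hf x)); rewrite leeDr.
rewrite addeC; apply: addS; first exact: integral_ge0.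
  exact: integral_le_ub.
move=> gfin; apply: integral_le_ub => // h hf.
by rewrite leeBrDr// hS.
Qed.

Lemma le_integral_sum (k : nat) (f : 'I_k -> T -> \bar R) :
  (forall i x, 0 <= f i x) ->
  \sum_(i < k) \int[mu]_x f i x <= \int[mu]_x \sum_(i < k) f i x.
Proof.
elim: k f => [|k IHk] f f0.
  by rewrite big_ord0 integral_ge0// => x _; rewrite big_ord0.
rewrite big_ord_recl.
rewrite [leRHS](eq_integral (fun x => f ord0 x + \sum_(i < k) f (lift ord0 i) x)); last first.
  by move=> x _; rewrite big_ord_recl.
apply: le_trans (le_integralD _ _ _ _) => //; last by move=> x; exact: sume_ge0.
by rewrite leeD2l// IHk.
Qed.

End LowerIntegral.

(** * Averaging over the samples *)

Section Expectation.
Context {R : realType} {d : nat} {dT : measure_display} {T : measurableType dT}.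
Variables (D : probability T R) (F : T -> 'rV[R]_d -> R).
Hypothesis intF : forall x, D.-integrable setT (fun xi => (F xi x)%:E).
Implicit Types x y : 'rV[R]_d.

Lemma Eiid_ge0 (k : nat) (h : seq T -> \bar R) :
  (forall s, (0 <= h s)%E) -> (0 <= Eiid D k h)%E.
Proof.
by elim: k h => [|k IHk] h h0 //=; apply: integral_ge0 => xi _; exact: IHk.
Qed.

(** The measurable majorants of both recursions have this form, and their integrals are computed
    exactly by linearity. *)
Lemma integrable_affine_gap x y (a b : R) :
  D.-integrable setT (fun xi => (a - b * (F xi x - F xi y))%:E).
Proof.
exact: (integrableB measurableT (finite_measure_integrable_cst D a measurableT)
  (integrableZl measurableT b (integrableB measurableT (intF x) (intF y)))).
Qed.

Lemma integral_affine_gap x y (a b : R) :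
  (\int[D]_xi (a - b * (F xi x - F xi y))%:E)%E =
  (a - b * (fmean D F x - fmean D F y))%:E.
Proof.
have iB := integrableB measurableT (intF x) (intF y).
have iC := finite_measure_integrable_cst D a measurableT.
have EB := integralB measurableT (intF x) (intF y).
have EZ := integralZl measurableT iB b.
have EC : (\int[D]_xi cst a%:E xi)%E = a%:E.
  by rewrite integral_cst// [X in (_ * X)%E](probability_setT D) mule1.
have -> : (\int[D]_xi (a - b * (F xi x - F xi y))%:E)%E =
    (\int[D]_xi (a%:E - b%:E * ((F xi x)%:E - (F xi y)%:E)))%E by [].
rewrite (integralB measurableT iC (integrableZl measurableT b iB)) EC EZ EB.
by rewrite /fmean EFinB EFinM EFinB !fineK ?integrable_fin_num.
Qed.

Lemma fmean_le x y : {ae D, forall xi, F xi y <= F xi x} -> fmean D F y <= fmean D F x.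
Proof.
move=> yx; have : (\int[D]_xi (cst 0%E xi) <= \int[D]_xi (0 - -1 * (F xi x - F xi y))%:E)%E.
  apply: ae_le_integral_majorant => //.
    exact: measurable_int (integrable_affine_gap x y 0 (-1)).
  by apply: filterS yx => xi yx; rewrite lee_fin; lra.
by rewrite integral0 integral_affine_gap lee_fin; lra.
Qed.

(** * The two recursions over the iterations *)

Section Rates.
Variables (prox : T -> 'rV[R]_d -> 'rV[R]_d) (xs : 'rV[R]_d) (C r : R).
Hypothesis C0 : 0 < C.
Hypothesis min_xs : {ae D, forall xi, forall x, F xi xs <= F xi x}.
Hypothesis step : {ae D, forall xi, forall x, enorm (x - xs) <= r ->
  enorm (prox xi x - xs) <= enorm (x - xs) /\
  F xi x - F xi xs <= C * (enorm (x - xs) ^+ 2 - enorm (prox xi x - xs) ^+ 2)}.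

Lemma fmean_gap_ge0 x : 0 <= fmean D F x - fmean D F xs.
Proof. by rewrite subr_ge0; apply: fmean_le; apply: filterS min_xs => xi; exact. Qed.

(** Induction from an arbitrary start in the ball, peeling off the first sample: the later gaps cost
    at most [C] times the new squared distance, and [step] pays for the first gap. *)
Lemma sum_gap_sppm_le (k : nat) x : enorm (x - xs) <= r ->
  (\sum_(i < k) Eiid D i (fun s =>
     (fmean D F (sppm prox x s) - fmean D F xs)%:E)
   <= (C * enorm (x - xs) ^+ 2)%:E)%E.
Proof.
elim: k x => [|k IHk] x xr.
  by rewrite big_ord0 lee_fin mulr_ge0 ?sqr_ge0// ltW.
rewrite big_ord_recl /=.
apply: (@le_trans _ _ ((fmean D F x - fmean D F xs)%:E +
  \int[D]_xi \sum_(i < k) Eiid D i (fun s =>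
     (fmean D F (sppm prox (prox xi x) s) - fmean D F xs)%:E))%E).
  (* Superadditivity moves the sum inside the integral over the first sample. *)
  rewrite leeD2l//; apply: le_integral_sum => i xi.
  by apply: Eiid_ge0 => s; rewrite lee_fin fmean_gap_ge0.
apply: (@le_trans _ _ ((fmean D F x - fmean D F xs)%:E +
  \int[D]_xi (C * enorm (x - xs) ^+ 2 - 1 * (F xi x - F xi xs))%:E)%E).
  rewrite leeD2l//; apply: ae_le_integral_majorant => [xi||].
  - apply: sume_ge0 => i _; apply: Eiid_ge0 => s.
    by rewrite lee_fin fmean_gap_ge0.
  - exact: measurable_int (integrable_affine_gap _ _ _ _).
  - apply: filterS step => xi /(_ x xr)[pr gap].
    by apply: le_trans (IHk _ (le_trans pr xr)) _; rewrite lee_fin; lra.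
by rewrite integral_affine_gap -EFinD lee_fin; lra.
Qed.

(** The factor [p] is any nonnegative bound on [1 - mu / (2 * C)], as the induction multiplies
    inequalities by [p ^+ k]. *)
Lemma Eiid_sqdist_le (mu p : R) : 0 <= p -> 1 - mu / (2 * C) <= p ->
  (forall x, mu / 2 * enorm (x - xs) ^+ 2 <= fmean D F x - fmean D F xs) ->
  forall (k : nat) x, enorm (x - xs) <= r ->
  (Eiid D k (fun s => (enorm (sppm prox x s - xs) ^+ 2)%:E)
   <= (p ^+ k * enorm (x - xs) ^+ 2)%:E)%E.
Proof.
move=> p0 mup growth; elim=> [|k IHk] x xr /=; first by rewrite expr0 mul1r.
set n := enorm (x - xs) ^+ 2.
apply: (@le_trans _ _
  (\int[D]_xi (p ^+ k * n - p ^+ k / C * (F xi x - F xi xs))%:E)%E).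
  apply: ae_le_integral_majorant => [xi||].
  - by apply: Eiid_ge0 => s; rewrite lee_fin sqr_ge0.
  - exact: measurable_int (integrable_affine_gap _ _ _ _).
  - apply: filterS step => xi /(_ x xr)[pr gap].
    apply: le_trans (IHk _ (le_trans pr xr)) _; rewrite lee_fin.
    rewrite -mulrA -mulrBr ler_wpM2l ?exprn_ge0//.
    suff : C^-1 * (F xi x - F xi xs) <= n - enorm (prox xi x - xs) ^+ 2 by lra.
    by rewrite ler_pdivrMl.
rewrite integral_affine_gap lee_fin -mulrA -mulrBr exprSr -mulrA.
rewrite ler_wpM2l ?exprn_ge0//.
apply: (@le_trans _ _ ((1 - mu / (2 * C)) * n)).
  have h : C^-1 * (mu / 2 * n) <= C^-1 * (fmean D F x - fmean D F xs).
    by apply: ler_wpM2l; [rewrite invr_ge0 ltW|exact: growth].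
  by rewrite mulrBl mul1r lerD2l lerN2 invfM; lra.
by rewrite ler_wpM2r ?sqr_ge0.
Qed.

End Rates.
End Expectation.

(** * Both rates for SPPM *)

Theorem theorem5p3 (R : realType) (d : nat)
  (dT : measure_display) (T : measurableType dT) (D : probability T R)
  (F : T -> 'rV[R]_d -> R) (phi : R -> R -> R)
  (xstar : 'rV[R]_d) (gamma : R) (x0 : 'rV[R]_d)
  (prox : T -> 'rV[R]_d -> 'rV[R]_d) :
  (* f(x) = E[f_xi(x)] is well defined (finite) *)
  (forall x, D.-integrable setT (fun xi => (F xi x)%:E)) ->
  (* (A1) differentiability *)
  {ae D, forall xi, forall x, differentiable (F xi) x} ->
  (* (A2) convexity *)
  {ae D, forall xi, convex_function setT (F xi)} ->
  (* (A4) interpolation at xstar *)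
  {ae D, forall xi, grad (F xi) xstar = 0} ->
  (* (phi) phi-smoothness, phi nonnegative and nondecreasing in each variable *)
  (forall a b, 0 <= a -> 0 <= b -> 0 <= phi a b) ->
  (forall a a' b, 0 <= a -> a <= a' -> 0 <= b -> phi a b <= phi a' b) ->
  (forall a b b', 0 <= a -> 0 <= b -> b <= b' -> phi a b <= phi a b') ->
  {ae D, forall xi, forall x y,
     enorm (grad (F xi) x - grad (F xi) y)
       <= phi (enorm (x - y)) (enorm (grad (F xi) y)) * enorm (x - y)} ->
  (* SPPM step: prox xi x = argmin_z { f_xi(z) + ||z - x||^2 / (2 gamma) } *)
  0 < gamma ->
  {ae D, forall xi, forall x z,
     F xi (prox xi x) + (2 * gamma)^-1 * enorm (prox xi x - x) ^+ 2
       <= F xi z + (2 * gamma)^-1 * enorm (z - x) ^+ 2} ->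
  (* the SPPM step map is jointly (Borel) measurable, so iterates are r.v.'s *)
  measurable_fun setT
    (fun p : T * vborel R d => (prox p.1 p.2 : vborel R d)) ->
  let Phi := phi (enorm (x0 - xstar)) (gamma^-1 * enorm (x0 - xstar)) in
  (* sublinear rate for the uniformly sampled iterate hat x_k *)
  (forall k : nat, (1 <= k)%N ->
     ((k%:R)^-1%:E *
        \sum_(i < k) Eiid D i (fun s =>
           (fmean D F (sppm prox x0 s) - fmean D F xstar)%:E)
      <= ((Phi + 2 / gamma) / (2 * k%:R) * enorm (x0 - xstar) ^+ 2)%:E)%E) /\
  (* linear rate under (A3) *)
  (forall mu : R, 0 < mu ->
     (forall x, differentiable (fmean D F) x) ->
     (forall x y, fmean D F x >= fmean D F y
        + dotv (grad (fmean D F) y) (x - y) + mu / 2 * enorm (x - y) ^+ 2) ->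
     forall k : nat,
       (Eiid D k (fun s => (enorm (sppm prox x0 s - xstar) ^+ 2)%:E)
        <= ((1 - mu / (2 / gamma + Phi)) ^+ k * enorm (x0 - xstar) ^+ 2)%:E)%E).
Proof.
move=> intF dF cF gF phi0 phil phir smooth gamma0 pmin _ Phi.
(* [C] is half of [Phi + 2 / gamma], the constant in both rates. *)
set r := enorm (x0 - xstar); set C := Phi / 2 + gamma^-1.
have r0 : 0 <= r := enorm_ge0 _.
have Phi0 : 0 <= Phi by apply: phi0; rewrite // mulr_ge0// invr_ge0 ltW.
have C0 : 0 < C by rewrite ltr_wpDl ?invr_gt0// divr_ge0.
have min_xs : {ae D, forall xi, forall x, F xi xstar <= F xi x}.
  apply: filterS (filterI dF (filterI cF gF)) => xi [dfx [cfx gfx]] x.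
  have := convex_grad_le _ x xstar (dfx _) cfx.
  by rewrite gfx dotv0l addr0.
have step : {ae D, forall xi, forall x, enorm (x - xstar) <= r ->
  enorm (prox xi x - xstar) <= enorm (x - xstar) /\
  F xi x - F xi xstar <=
    C * (enorm (x - xstar) ^+ 2 - enorm (prox xi x - xstar) ^+ 2)}.
  apply: filterS (filterI (filterI dF cF) (filterI gF (filterI smooth pmin))).
  move=> xi [[dfx cfx] [gfx [sfx pfx]]] x xr.
  by apply: (prox_step (F xi) phi) => //; exact: pfx.
have sublinear := sum_gap_sppm_le _ _ intF _ _ _ _ C0 min_xs step _ x0 (lexx _).
split=> [k k_gt0|mu mu0 dfm sc k].
  have k0 : 0 < k%:R :> R by rewrite ltr0n.
  have -> : (Phi + 2 / gamma) / (2 * k%:R) * r ^+ 2 = k%:R^-1 * (C * r ^+ 2).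
    by rewrite /C; field; rewrite !gt_eqF.
  by rewrite EFinM; apply: lee_wpmul2l; [rewrite lee_fin invr_ge0 ltW|exact: sublinear].
have g0 : grad (fmean D F) xstar = 0.
  rewrite (grad_min _ _ 0 0 (dfm _)) ?oppr0// => z.
  rewrite mul0r dotv0l !addr0; apply: fmean_le => //.
  by apply: filterS min_xs => xi; exact.
have growth x : mu / 2 * enorm (x - xstar) ^+ 2 <= fmean D F x - fmean D F xstar.
  by have := sc x xstar; rewrite g0 dotv0l; lra.
have -> : 2 / gamma + Phi = 2 * C by rewrite /C; lra.
have linear := Eiid_sqdist_le _ _ intF _ _ _ _ C0 step mu _ _ _ growth k x0 (lexx _).
(* If the factor is negative, then [C < mu / 2]; growth and the sublinear bound for one iterate
   force [r = 0], and [linear] with [p = 0] finishes. *)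
have [q0|q_lt0] := leP 0 (1 - mu / (2 * C)); first exact: linear.
have n0 : r ^+ 2 = 0.
  apply/eqP; rewrite eq_le sqr_ge0 andbT.
  have := sublinear 1; rewrite big_ord_recl big_ord0 adde0 /= lee_fin => gapC.
  have Cmu : C < mu / 2.
    by move: q_lt0; rewrite subr_lt0 ltr_pdivlMr ?mulr_gt0//; lra.
  have := le_trans (growth x0) gapC.
  by rewrite -subr_le0 -mulrBl pmulr_rle0 ?subr_gt0.
by have := linear 0 (lexx _) (ltW q_lt0); rewrite -/r n0 !mulr0.
Qed.
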